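(* Let $S$ and $T$ be numerical semigroups of the same multiplicity $m$ whose Apéry coordinate vectors lie in the relative interior of the same face $F$ of the Kunz cone $C_m$. Then $\beta_d(J_S)=\beta_d(J_T)$ and $\beta_d(I_S)=\beta_d(I_T)$ for all $d\ge0$.
   Context: A numerical semigroup is a submonoid $S\subseteq(\mathbb Z_{\ge0},+)$ containing $0$ with finite complement; its multiplicity is $m=\min(S\setminus\{0\})\ge2$; $\mathcal A(S)$ is its minimal generating set. Its Apéry set is $\{n\in S:n-m\notin S\}=\{0,a_1,\dots,a_{m-1}\}$ with $a_i\equiv i\pmod m$, and its Apéry coordinate vector is $(a_1,\dots,a_{m-1})$. The Kunz cone $C_m\subseteq\mathbb R_{\ge0}^{m-1}$ is defined by the inequalities $z_i+z_j\ge z_{i+j}$ for $1\le i\le j\le m-1$, $i+j\ne m$ (subscripts mod $m$). Let $R=\Bbbk[x_0,\dots,x_{m-1}]$ over a field $\Bbbk$, graded by $\deg x_0=m$, $\deg x_i=a_i$ (for the semigroup in question). The Apéry toric ideal is $J_S=\ker(R\to\Bbbk[t],\ x_0\mapsto t^m,\ x_i\mapsto t^{a_i})$; the defining toric ideal is $I_S=J_S\cap\Bbbk[x_0,x_i: a_i\in\mathcal A(S)]$. $\beta_d(I)$ denotes the $d$-th (total) Betti number of the graded ideal $I$ over its ambient polynomial ring, i.e. the rank of the $d$-th module in a minimal graded free resolution of $I$. *)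

(* Defs.v *)
From HB Require Import structures.
From mathcomp Require Import all_boot all_order all_algebra.
From mathcomp Require Import reals.
From mathcomp Require Import mpoly.
Set Implicit Arguments. Unset Strict Implicit. Unset Printing Implicit Defensive.
Import Order.TTheory GRing.Theory Num.Theory.
Local Open Scope ring_scope.

Definition numerical_semigroup (S : pred nat) : Prop :=
  [/\ S 0%N,
      (forall a b, S a -> S b -> S (a + b)%N) &
      (exists N, forall n, (N <= n)%N -> S n)].

Definition multiplicity (S : pred nat) (m : nat) : Prop :=
  [/\ S m, (0 < m)%N & forall k, (0 < k)%N -> (k < m)%N -> ~~ S k].

(* n is the Apery element of S (w.r.t. m) in residue class i:
   n \in S, n - m \notin S (as an integer), and n = i mod m. *)
Definition apery_elem (S : pred nat) (m i n : nat) : Prop :=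
  [/\ S n, (n %% m = i %% m)%N & ((n < m)%N \/ ~~ S (n - m)%N)].

(* a i = a_i is the Apery element congruent to i (so a 0 = 0). *)
Definition apery_vec (S : pred nat) (m : nat) (a : 'I_m -> nat) : Prop :=
  forall i : 'I_m, apery_elem S m i (a i).

Definition atomb (S : pred nat) (a : nat) : bool :=
  [&& S a, (0 < a)%N &
      ~~ [exists b : 'I_a, [&& (0 < (b : nat))%N, S b & S (a - b)%N]]].

(* Points of R^(m-1) with coordinates z_1..z_(m-1) are represented as *)
(* functions 'I_m -> R whose coordinate 0 vanishes.                   *)

Definition zat (R : realType) (m : nat) (z : 'I_m -> R) (l : nat) : R :=
  oapp z 0 (insub (l %% m)%N).

Definition kunz_cone (R : realType) (m : nat) (z : 'I_m -> R) : Prop :=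
  [/\ (forall i : 'I_m, (i : nat) = 0%N -> z i = 0),
      (forall i : 'I_m, (0 < (i : nat))%N -> 0 <= z i) &
      (forall i j : 'I_m, (0 < (i : nat))%N -> (i <= j)%N ->
         ((i + j) %% m != 0)%N -> zat z (i + j)%N <= z i + z j)].

Definition dotv (R : realType) (m : nat) (c z : 'I_m -> R) : R :=
  \sum_(i < m) c i * z i.

(* F is a face of the (closed convex) cone C: the intersection of C with
   a supporting hyperplane through the origin (c = 0 gives C itself). *)
Definition is_face (R : realType) (m : nat)
    (C F : ('I_m -> R) -> Prop) : Prop :=
  exists c : 'I_m -> R,
    (forall z, C z -> 0 <= dotv c z) /\
    (forall z, F z <-> (C z /\ dotv c z = 0)).

Definition aff_hull (R : realType) (m : nat)
    (F : ('I_m -> R) -> Prop) (y : 'I_m -> R) : Prop :=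
  exists (N : nat) (lam : 'I_N -> R) (pts : 'I_N -> ('I_m -> R)),
    [/\ (forall j, F (pts j)),
        \sum_(j < N) lam j = 1 &
        forall i, y i = \sum_(j < N) lam j * pts j i].

Definition rel_interior (R : realType) (m : nat)
    (F : ('I_m -> R) -> Prop) (x : 'I_m -> R) : Prop :=
  F x /\ exists2 e : R, 0 < e &
    forall y, aff_hull F y -> (forall i, `|y i - x i| < e) -> F y.

Definition apery_point (R : realType) (m : nat) (a : 'I_m -> nat) :
  'I_m -> R := fun i => (a i)%:R.

Section Graded.
Variables (k : fieldType) (n : nat) (w : 'I_n -> nat).

Definition wdeg (mo : 'X_{1..n}) : nat := (\sum_(i < n) w i * mo i)%N.

Definition whomog (d : nat) (p : {mpoly k[n]}) : Prop :=
  forall mo, mo \in msupp p -> wdeg mo = d.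

Definition toric_ideal : pred {mpoly k[n]} :=
  fun p => mmap (@polyC k) (fun i => 'X^(w i)) p == 0.

(* A minimal graded free resolution of the ideal I:
     ... -> F_(d+1) --dif d--> F_d -> ... -> F_0 --aug--> I -> 0
   with F_d = P^(rk d) (row vectors), generator degrees gdeg d,
   degree-preserving maps (homogeneous matrix entries), exactness,
   and minimality (all entries lie in the homogeneous maximal ideal,
   i.e. have zero constant term). *)
Definition min_graded_free_res (I : pred {mpoly k[n]})
    (rk : nat -> nat) (gdeg : forall d, 'I_(rk d) -> nat)
    (aug : 'M[{mpoly k[n]}]_(rk 0%N, 1))
    (dif : forall d, 'M[{mpoly k[n]}]_(rk d.+1, rk d)) : Prop :=
  [/\ (* gradedness of aug (target generator in degree 0) *)
      (forall j, whomog (gdeg 0%N j) (aug j ord0)),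
      (forall d j i, whomog (gdeg d.+1 j - gdeg d i)%N (dif d j i) /\
                     ((gdeg d.+1 j < gdeg d i)%N -> dif d j i = 0)),
      (forall j, mcoeff 0%MM (aug j ord0) = 0) /\
      (forall d j i, mcoeff 0%MM (dif d j i) = 0),
      (forall p, p \in I <-> exists v : 'rV_(rk 0%N), (v *m aug) ord0 ord0 = p) &
      (forall u : 'rV_(rk 0%N), u *m aug = 0 <-> exists v, u = v *m dif 0%N) /\
      (forall d (u : 'rV_(rk d.+1)), u *m dif d = 0 <-> exists v, u = v *m dif d.+1)].

Definition betti (I : pred {mpoly k[n]}) (d b : nat) : Prop :=
  (exists rk gdeg aug dif, @min_graded_free_res I rk gdeg aug dif) /\
  (forall rk gdeg aug dif, @min_graded_free_res I rk gdeg aug dif -> rk d = b).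

End Graded.

Definition apery_weights (m : nat) (a : 'I_m -> nat) : 'I_m -> nat :=
  fun i => if (i : nat) == 0%N then m else a i.

Definition J_ideal (k : fieldType) (m : nat) (a : 'I_m -> nat)
  : pred {mpoly k[m]} := @toric_ideal k _ (apery_weights a).

Definition gen_vars (S : pred nat) (m : nat) (a : 'I_m -> nat) : {set 'I_m} :=
  [set j : 'I_m | ((j : nat) == 0%N) || atomb S (a j)].

Definition gen_weights (S : pred nat) (m : nat) (a : 'I_m -> nat) :
  'I_#|gen_vars S a| -> nat :=
  fun j => apery_weights a (enum_val j).

(* I_S = J_S \cap k[x_0, x_i : a_i \in A(S)], as an ideal of that ring *)
Definition I_ideal (k : fieldType) (S : pred nat) (m : nat) (a : 'I_m -> nat)
  : pred {mpoly k[#|gen_vars S a|]} := @toric_ideal k _ (@gen_weights S m a).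

(* Main.v *)
Require Import Defs.
From HB Require Import structures.
From mathcomp Require Import all_boot all_order all_algebra.
From mathcomp Require Import reals.
From mathcomp Require Import mpoly.
From mathcomp Require Import zify.
From mathcomp Require boolp.
Set Implicit Arguments. Unset Strict Implicit. Unset Printing Implicit Defensive.
Import Order.TTheory GRing.Theory Num.Theory.
Local Open Scope ring_scope.

(* Write x for the variable of weight m. It is a nonzerodivisor on the polynomial
   ring and modulo a toric ideal, so a minimal resolution stays exact and minimal
   after reduction modulo x. Modulo x the ideal of S consists of the polynomials
   whose coefficients sum to 0 over the monomials of weight a_i, for each i, and
   which monomials have weight a_i depends only on the set of equalities
   a_i + a_j = a_(i+j), that is, on the face containing the Apery vector in its
   relative interior. Hence the ideals of S and T coincide modulo x, although
   they are homogeneous for different gradings. Ranks of minimal resolutions can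
   be compared without any grading: comparison maps between two complexes of free
   modules that are exact modulo x are mutually inverse up to homotopy, hence
   become invertible over k on constant terms. Existence of minimal resolutions
   comes from Hilbert's basis theorem. *)

(** * Noetherian rings *)

Section Span.
Variables (A : comNzRingType) (M : lmodType A).
Implicit Types (s : seq M) (K : M -> Prop).

(** One existential coefficient per generator: proofs go by induction on [s] instead of through
    indexed sums. *)
Fixpoint spanned s (x : M) : Prop :=
  if s is g :: s' then exists a : A, spanned s' (x - a *: g) else x = 0.

Definition submodule K : Prop :=
  K 0 /\ forall c x y, K x -> K y -> K (c *: x + y).

Definition fin_gen K : Prop :=
  exists s, (forall x, x \in s -> K x) /\ (forall x, K x -> spanned s x).

Lemma spanned0 s : spanned s 0.
Proof. by elim: s => //= g s IH; exists 0; rewrite scale0r subr0. Qed.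

Lemma spannedZD s c x y :
  spanned s x -> spanned s y -> spanned s (c *: x + y).
Proof.
elim: s x y => [|g s IH] x y /=; first by move=> -> ->; rewrite scaler0 addr0.
move=> [a Ha] [b Hb]; exists (c * a + b); have := IH _ _ Ha Hb.
by rewrite scalerBr scalerA scalerDl opprD addrACA.
Qed.

Lemma submodule_spanned s : submodule (spanned s).
Proof. by split; [exact: spanned0 | move=> *; exact: spannedZD]. Qed.

Lemma spanned_mem s x : x \in s -> spanned s x.
Proof.
elim: s => //= g s IH; rewrite inE => /predU1P[->|/IH xs].
  by exists 1; rewrite scale1r subrr; exact: spanned0.
by exists 0; rewrite scale0r subr0.
Qed.

Lemma spanned_min s K : submodule K -> (forall x, x \in s -> K x) ->
  forall x, spanned s x -> K x.
Proof.
move=> [K0 KZD]; elim: s => [|g s IH] sK x /=; first by move->.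
move=> [a xa]; rewrite -(subrK (a *: g) x) addrC; apply: KZD.
  by apply: sK; rewrite mem_head.
by apply: IH xa => y ys; apply: sK; rewrite inE ys orbT.
Qed.

Lemma spanned_sub s t x :
  {subset s <= t} -> spanned s x -> spanned t x.
Proof.
move=> st; apply: spanned_min (submodule_spanned t) _ _ => y /st.
exact: spanned_mem.
Qed.

Lemma spanned_sum s n (F : 'I_n -> M) :
  (forall i, spanned s (F i)) -> spanned s (\sum_i F i).
Proof.
move=> sF; elim/big_ind: _ => //; first exact: spanned0.
by move=> x y sx sy; rewrite -(scale1r x); exact: spannedZD.
Qed.

End Span.

Lemma spanned_lift (A : comNzRingType) (M N : lmodType A) (f : M -> N)
    (f_lin : forall c x y, f (c *: x + y) = c *: f x + f y) (s : seq M) a :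
  spanned (map f s) a -> exists2 y, spanned s y & f y = a.
Proof.
elim: s a => [|g s IH] a /=.
  move=> ->; exists 0 => //.
  by have := f_lin (-1) 0 0; rewrite scaler0 addr0 scaleN1r addNr.
case=> c /IH[y sy fy]; exists (c *: g + y).
  by exists c; rewrite addrC addKr.
by rewrite f_lin fy addrC subrK.
Qed.

Definition noetherian (A : comNzRingType) : Prop :=
  forall K : A^o -> Prop, submodule K -> fin_gen K.

Lemma lift_seq (X Y : eqType) (K : X -> Prop) (f : X -> Y) (t : seq Y) :
  (forall a, a \in t -> exists2 x, K x & f x = a) ->
  exists2 s, (forall x, x \in s -> K x) & map f s = t.
Proof.
elim: t => [|a t IH] tP; first by exists [::].
have [|s sK <-] := IH; first by move=> b bt; apply: tP; rewrite inE bt orbT.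
have [x Kx <-] := tP a (mem_head _ _); exists (x :: s) => // y.
by rewrite inE => /predU1P[->|/sK].
Qed.

(** The values of the first form on [K] make up an ideal; lifts of its generators reduce [K] to the
    kernel of that form, which the remaining forms separate. This serves both row vectors and
    polynomials of bounded size. *)
Lemma fin_gen_coordinates (A : comNzRingType) (M : lmodType A) (I : eqType)
    (f : I -> M -> A) (s : seq I) (K : M -> Prop) :
  noetherian A ->
  (forall i c x y, f i (c *: x + y) = c * f i x + f i y) ->
  submodule K ->
  (forall x, K x -> (forall i, i \in s -> f i x = 0) -> x = 0) ->
  fin_gen K.
Proof.
move=> noethA f_lin; elim: s K => [|i s IH] K [K0 KZD] Kinj.
  by exists [::]; split=> // x Kx; apply: Kinj.
have f0 j : f j 0 = 0 by have := f_lin j (-1) 0 0; rewrite scaler0 addr0 mulN1r addNr.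
pose L (a : A^o) := exists2 x, K x & f i x = a.
have [|t [tL Lt]] := noethA L.
  split; first by exists 0.
  move=> c _ _ [x Kx <-] [y Ky <-]; exists (c *: x + y); first exact: KZD.
  by rewrite f_lin.
have [u uK def_t] := lift_seq tL.
have [||v [vK Kv]] := IH (fun x => K x /\ f i x = 0).
- split=> // c x y [Kx fx] [Ky fy]; split; first exact: KZD.
  by rewrite f_lin fx fy mulr0 addr0.
- move=> x [Kx fx] fsx; apply: Kinj => // j.
  by rewrite inE => /predU1P[->|/fsx].
exists (u ++ v); split=> [x|x Kx].
  by rewrite mem_cat => /orP[/uK|/vK[]].
have : spanned t (f i x : A^o) by apply: Lt; exists x.
rewrite -def_t => /(@spanned_lift _ M A^o (f i) (f_lin i))[y uy fy].
have Ky : K y by apply: spanned_min uy.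
have /Kv vxy : K (x - y) /\ f i (x - y) = 0.
  rewrite addrC -scaleN1r; split; first exact: KZD.
  by rewrite f_lin fy mulN1r addNr.
rewrite -(subrK y x) -(scale1r (x - y)); apply: spannedZD.
  by apply: spanned_sub vxy => z zv; rewrite mem_cat zv orbT.
by apply: spanned_sub uy => z zv; rewrite mem_cat zv.
Qed.

Lemma noetherian_rV (A : comNzRingType) r (K : 'rV[A]_r -> Prop) :
  noetherian A -> submodule K -> fin_gen K.
Proof.
move=> noethA subK.
apply: (@fin_gen_coordinates _ _ _ (fun i (u : 'rV_r) => u 0 i) (enum 'I_r)) => //.
  by move=> i c x y; rewrite !mxE.
move=> x _ x0; apply/rowP => i; rewrite mxE; apply: x0.
by rewrite mem_enum.
Qed.

Lemma spannedB (A : comNzRingType) (M : lmodType A) (s : seq M) (x y : M) :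
  spanned s y -> spanned s (x - y) -> spanned s x.
Proof. by move=> sy sxy; rewrite -(subrK y x) -(scale1r (x - y)); apply: spannedZD. Qed.

Lemma spannedM (A : comNzRingType) (s : seq A^o) (c x : A) :
  spanned s (x : A^o) -> spanned s (c * x : A^o).
Proof. by move=> sx; rewrite -[c * x]addr0; apply: spannedZD => //; exact: spanned0. Qed.

Lemma size_coef_shift (A : comNzRingType) (c : A) e d (f : {poly A}) :
  (size f <= d.+1)%N ->
  (size (c *: 'X^e * f)%R <= (d + e).+1)%N /\ (c *: 'X^e * f)`_(d + e) = c * f`_d.
Proof.
move=> sf; rewrite -scalerAl coefZ coefXnM ltnNge leq_addl /= addnK; split=> //.
rewrite (leq_trans (size_scale_leq _ _)) // (leq_trans (size_polyMleq _ _)) //.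
by rewrite size_polyXn addSn /= addnC -addSn leq_add2r.
Qed.

(* The leading coefficients of an ideal K come from finitely many elements of K,
   all of degree at most D; these reduce K to its elements of size at most D,
   which form a finitely generated module over A. *)
Lemma noetherian_poly (A : comNzRingType) :
  noetherian A -> noetherian {poly A}.
Proof.
move=> noethA K [K0 KZD].
have KM c f : K f -> K (c * f) by move=> Kf; rewrite -[c * f]addr0; exact: KZD.
have KD f g : K f -> K g -> K (f + g).
  by move=> Kf Kg; rewrite -[f](scale1r (f : {poly A}^o)); exact: KZD.
have KN f : K f -> K (- f) by move=> Kf; rewrite -mulN1r; exact: KM.
(* Here [d] only bounds the degree, so [a] may be 0 and [L] is closed under linear combinations. *)
pose L (a : A^o) := exists f : {poly A}, exists d,
  [/\ K f, (size f <= d.+1)%N & f`_d = a].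
have [|t [tL Lt]] := noethA L.
  split; first by exists 0, 0%N; rewrite size_poly0 coef0.
  move=> c a b [f [d [Kf sf fa]]] [g [e [Kg sg gb]]].
  have [sf' cf'] := size_coef_shift c e sf; have [sg' cg'] := size_coef_shift 1 d sg.
  rewrite addnC in sg' cg'; exists (c *: 'X^e * f + 1 *: 'X^d * g), (d + e)%N; split.
  - by apply: KD; apply: KM.
  - by rewrite (leq_trans (size_polyD _ _)) // geq_max sf' sg'.
  - by rewrite coefD cf' cg' mul1r fa gb.
(* Shifts by powers of ['X] bring the lifts of all generators of [L] to one common degree [D]. *)
have {tL} [D [s [sK sD]]] : exists D (s : seq {poly A}^o),
    (forall f, f \in s -> K f) /\
    forall a, spanned t a -> exists f : {poly A}^o,
      [/\ spanned s f, (size (f : {poly A}) <= D.+1)%N & (f : {poly A})`_D = a].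
  elim: t tL {Lt} => [|b t IH] tL.
    exists 0%N, [::]; split=> // a /= ->; exists 0.
    by rewrite size_poly0 coef0.
  have [|D [s [sK sD]]] := IH; first by move=> a at_; apply: tL; rewrite inE at_ orbT.
  have [f [d [Kf sf fb]]] := tL b (mem_head _ _).
  exists (D + d)%N, (f :: s); split.
    by move=> g; rewrite inE => /predU1P[->|/sK].
  move=> a /= [c /sD[g [sg szg ga]]].
  have [sf' cf'] := size_coef_shift c D sf; have [sg' cg'] := size_coef_shift 1 d szg.
  rewrite addnC in sf' cf'; exists (c *: 'X^D * f + 1 *: 'X^d * g); split.
  - by exists (c *: 'X^D); rewrite addrC addKr; exact: spannedM.
  - by rewrite (leq_trans (size_polyD _ _)) // geq_max sf' sg'.
  - by rewrite coefD cf' cg' mul1r fb ga addrC subrK.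
pose KD' (f : {poly A}) := K f /\ (size f <= D)%N.
have [|||u [uK Ku]] :=
  @fin_gen_coordinates A {poly A} nat (fun i p => p`_i) (iota 0 D) KD' noethA.
- by move=> i c f g; rewrite coefD coefZ.
- split; first by split=> //; rewrite size_poly0.
  move=> c f g [Kf sf] [Kg sg]; split.
    by apply: KD => //; rewrite -mul_polyC; exact: KM.
  rewrite (leq_trans (size_polyD _ _)) // geq_max sg.
  by rewrite (leq_trans (size_scale_leq _ _)).
- move=> f [_ sf] f0; apply/polyP => i; rewrite coef0.
  case: (ltnP i D) => iD; first by apply: f0; rewrite mem_iota.
  by rewrite nth_default // (leq_trans sf).
exists (s ++ u : seq {poly A}^o); split.
  by move=> f; rewrite mem_cat => /orP[/sK|/uK[]].
have subs (f : {poly A}^o) : spanned s f -> spanned (s ++ u : seq {poly A}^o) f.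
  by apply: spanned_sub => g gs; rewrite mem_cat gs.
move=> f; have [n] := ubnP (size (f : {poly A})); elim: n f => // n IH f.
rewrite ltnS => sfn Kf; case: (leqP (size (f : {poly A})) D) => [sfD|].
  have : @spanned A {poly A} u f by apply: Ku.
  apply: (@spanned_min A {poly A} _ (fun f => @spanned {poly A} {poly A}^o _ f)).
    split; first exact: spanned0.
    move=> c x y sx sy; rewrite -mul_polyC -[_ + y]/(c%:P *: (x : {poly A}^o) + y).
    exact: spannedZD.
  by move=> g gu; apply: spanned_mem; rewrite mem_cat gu orbT.
move=> Dsf; pose e := ((size (f : {poly A})).-1 - D)%N.
have def_sf : size (f : {poly A}) = (e + D).+1.
  by rewrite /e subnK ?(ltn_predK Dsf) // -ltnS (ltn_predK Dsf).
have [|h [sh szh hD]] := sD (f : {poly A})`_(e + D).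
  by apply: Lt; exists f, (e + D)%N; rewrite def_sf.
have Kh : K h by apply: spanned_min sh.
(* Subtracting ['X^e * h] cancels the leading coefficient of [f]. *)
apply: (@spannedB _ _ _ _ ('X^e * h : {poly A}^o)).
  by apply: spannedM; apply: subs.
apply: IH; last by apply: KD => //; apply: KN; exact: KM.
rewrite (leq_trans _ sfn) // def_sf ltnS.
apply/leq_sizeP => j; rewrite leq_eqVlt => /predU1P[<-|lt_j].
  by rewrite coefB coefXnM ltnNge leq_addr addKn hD subrr.
rewrite coefB coefXnM ltnNge (leq_trans _ (ltnW lt_j)) ?leq_addr //=.
rewrite !nth_default ?subrr ?def_sf // (leq_trans szh) //.
by rewrite ltn_subRL.
Qed.

Lemma noetherian_surj (A B : comNzRingType) (f : {rmorphism A -> B}) :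
  (forall b, exists a, f a = b) -> noetherian A -> noetherian B.
Proof.
move=> f_surj noethA K [K0 KZD].
have [|s [sK Ks]] := noethA (fun a => K (f a)).
  split; first by rewrite rmorph0.
  by move=> c x y Kx Ky; rewrite -[c *: x]/(c * x) rmorphD rmorphM; exact: KZD.
exists (map f s : seq B^o); split.
  by move=> _ /mapP[a /sK Ka ->].
move=> b; have [a <-] := f_surj b => /Ks {Ks sK}.
elim: s a => [|g s IH] a /=; first by move->; rewrite rmorph0.
move=> [c /IH sc]; exists (f c); move: sc.
by rewrite -[c *: g]/(c * g) rmorphB rmorphM.
Qed.

Lemma noetherian_field (k : fieldType) : noetherian k.
Proof.
move=> K [K0 KZD].
have [[x Kx x0]|K_0] := boolp.EM (exists2 x : k, K x & x != 0).
  exists [:: (x : k^o)]; split=> [y|y _]; first by rewrite inE => /eqP->.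
  by exists (y / x); rewrite /= -[_ *: _]/(y / x * x) divfK // subrr.
exists [::]; split=> // x Kx /=; apply/eqP; apply: contra_notT K_0 => x0.
by exists x.
Qed.

(** Sending the univariate variable to the last one maps polynomials over the ring in [n] variables
    onto the ring in [n.+1] variables; surjectivity is checked on monomials. *)
Lemma noetherian_mpoly (k : fieldType) n : noetherian {mpoly k[n]}.
Proof.
elim: n => [|n IH].
  apply: (@noetherian_surj k _ (@mpolyC 0 k)) _ (@noetherian_field k) => p.
  exists p@_0%MM; apply/mpolyP => mo; rewrite mcoeffC.
  have -> : mo = 0%MM by apply/mnmP => -[].
  by rewrite eqxx mulr1.
have comm_wX : commr_rmorph (@mwiden n k) 'X_ord_max by move=> p; exact: mulrC.
have [f fC fX] : exists2 f : {rmorphism {poly {mpoly k[n]}} -> {mpoly k[n.+1]}},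
    forall p, f p%:P = mwiden p & f 'X = 'X_ord_max.
  exists (horner_morph comm_wX); last exact: horner_morphX.
  by move=> p; exact: horner_morphC.
apply: (@noetherian_surj _ _ f) _ (noetherian_poly IH).
elim/mpolyind => [|c mo p _ _ [q fq]]; first by exists 0; exact: (rmorph0 f).
suff [r fr] : exists r, f r = 'X_[mo].
  exists ((c%:MP)%:P * r + q).
  by rewrite rmorphD rmorphM fq fr fC mwidenC mul_mpolyC.
rewrite mpolyXE_id; elim/big_ind: _ => [|_ _ [a <-] [b <-]|i _].
- by exists 1; rewrite rmorph1.
- by exists (a * b); rewrite rmorphM.
have [j ->|->] := unliftP ord_max i; last first.
  by exists ('X ^+ (mo ord_max)); rewrite rmorphXn fX.
exists (('X_j)%:P ^+ mo (lift ord_max j)); rewrite rmorphXn fC mwidenX mnmwiden1.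
congr ('X_[U_(_)] ^+ _).
by apply/val_inj; rewrite /= /bump leqNgt ltn_ord.
Qed.

(** * Toric ideals and Apery sets *)

Section Toric.
Variables (k : fieldType) (n : nat) (w : 'I_n -> nat).
Local Notation A := {mpoly k[n]}.
Local Notation phi := (mmap (@polyC k) (fun i => 'X^(w i))).

Lemma wdegD u v : wdeg w (u + v) = (wdeg w u + wdeg w v)%N.
Proof. by rewrite /wdeg -big_split; apply: eq_bigr => i _; rewrite mnmDE mulnDr. Qed.

Lemma wdeg0 : wdeg w 0%MM = 0%N.
Proof. by rewrite /wdeg big1 // => i _; rewrite mnm0E muln0. Qed.

Lemma wdegU i : wdeg w U_(i)%MM = w i.
Proof.
rewrite /wdeg (bigD1 i) //= big1 ?mnm1E ?eqxx ?muln1 ?addn0 // => j ji.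
by rewrite mnm1E eq_sym (negPf ji) muln0.
Qed.

Lemma mmap1_wdeg u : mmap1 (fun i => 'X^(w i) : {poly k}) u = 'X^(wdeg w u).
Proof.
rewrite /mmap1 /wdeg; elim/big_rec2: _ => [|i a b _ ->]; first by rewrite expr0.
by rewrite exprD exprM.
Qed.

Lemma toric_mapE (p : A) : phi p = \sum_(u <- msupp p) p@_u *: 'X^(wdeg w u).
Proof. by apply: eq_bigr => u _; rewrite mmap1_wdeg mul_polyC. Qed.

Lemma toric_mapX u : phi 'X_[u] = 'X^(wdeg w u).
Proof. by rewrite mmapX mmap1_wdeg. Qed.

Lemma toric_coef p e : p \in @toric_ideal k n w ->
  \sum_(u <- msupp p | wdeg w u == e) p@_u = 0.
Proof.
rewrite unfold_in toric_mapE => /eqP/(congr1 (fun q : {poly k} => q`_e)).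
rewrite coef0 coef_sum => {2}<-; rewrite big_mkcond; apply: eq_bigr => u _.
by rewrite coefZ coefXn eq_sym; case: eqP => _; rewrite ?mulr1 ?mulr0.
Qed.

Lemma toric_submodule c p q :
  p \in @toric_ideal k n w -> q \in @toric_ideal k n w ->
  c * p + q \in @toric_ideal k n w.
Proof.
rewrite !unfold_in => /eqP p0 /eqP q0.
by rewrite rmorphD rmorphM /= p0 q0 mulr0 addr0.
Qed.

Lemma toric0 : 0 \in @toric_ideal k n w.
Proof. by rewrite unfold_in rmorph0. Qed.

Lemma toricD p q :
  p \in @toric_ideal k n w -> q \in @toric_ideal k n w -> p + q \in @toric_ideal k n w.
Proof. by rewrite -[p in p + q]mul1r; exact: toric_submodule. Qed.

(** The image of ['X_i] is a power of the variable, hence nonzero in a domain. *)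
Lemma toric_cancelX i p : 'X_i * p \in @toric_ideal k n w -> p \in @toric_ideal k n w.
Proof.
rewrite !unfold_in rmorphM /= toric_mapX mulf_eq0 => /orP[|//].
by rewrite expf_eq0 polyX_eq0 andbF.
Qed.

End Toric.

(* [ap] selects the monomials that do not vanish in the quotient of the semigroup
   ring of [w] by the variable [i0]. *)
Lemma toric_sub_modX (k : fieldType) n (v w : 'I_n -> nat) (i0 : 'I_n)
    (ap : pred 'X_{1..n}) :
  (forall a, ~~ ap a -> exists b, wdeg w a = (w i0 + wdeg w b)%N) ->
  (forall a b, ap a -> (wdeg w b == wdeg w a) = (wdeg v b == wdeg v a)) ->
  (forall a b, ap a -> wdeg w b = wdeg w a -> ap b) ->
  forall p, p \in @toric_ideal k n v ->
    exists2 q, q \in @toric_ideal k n w & exists c, p = q + 'X_i0 * c.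
Proof.
move=> ap_red ap_vw ap_w p pI.
pose P (p : {mpoly k[n]}) :=
  exists2 q, q \in @toric_ideal k n w & exists c, p = q + 'X_i0 * c.
have PD f g : P f -> P g -> P (f + g).
  move=> [f' If [c ->]] [g' Ig [d ->]]; exists (f' + g'); first exact: toricD.
  by exists (c + d); rewrite mulrDr addrACA.
rewrite -/(P p) [p]mpolyE (bigID ap); apply: (PD); last first.
  (* A monomial outside [ap] has the weight of some ['X_i0 * 'X_[b]], and their difference is a
     binomial of the ideal. *)
  elim/big_ind: _ => [|//|a /ap_red[b ab]].
    by exists 0; [exact: toric0 | exists 0; rewrite mulr0 addr0].
  exists (p@_a *: ('X_[a] - 'X_i0 * 'X_[b])).
    rewrite unfold_in /= mmapZ rmorphB rmorphM /= !toric_mapX wdegU ab exprD.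
    by rewrite subrr mulr0.
  by exists (p@_a *: 'X_[b]); rewrite scalerBr -scalerAr subrK.
(* On [ap] the classes of equal weight for [w] and for [v] agree, and each lies entirely in [ap]; so
   the coefficient sums vanish for [w] because they do for [v]. *)
exists (\sum_(a <- msupp p | ap a) p@_a *: 'X_[a]).
  rewrite unfold_in rmorph_sum /=; apply/eqP/polyP => e.
  rewrite coef0 coef_sum.
  rewrite (eq_bigr (fun a => if wdeg w a == e then p@_a else 0)); last first.
    move=> a _; rewrite mmapZ /= toric_mapX mul_polyC coefZ coefXn eq_sym.
    by case: eqP; rewrite ?mulr1 ?mulr0.
  have [/hasP[a _ /andP[apa /eqP ae]]|/hasPn none] :=
      boolP (has (fun a => ap a && (wdeg w a == e)) (msupp p)).
    rewrite -big_mkcondr -[RHS](toric_coef (wdeg v a) pI); apply: eq_bigl => b.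
    rewrite -ae ap_vw //; case: eqP; last by rewrite andbF.
    by move/eqP; rewrite -ap_vw // => /eqP/ap_w->.
  rewrite big_seq_cond big1 // => a /andP[/none].
  by rewrite negb_and => /orP[/negPf->//|/negPf->].
by exists 0; rewrite mulr0 addr0.
Qed.

Section Apery.
Variables (S : pred nat) (m : nat).
Hypotheses (semiS : numerical_semigroup S) (multS : multiplicity S m).

(** The disjunct [s < m] covers truncated subtraction, where [s - m] would be 0, an element of
    [S]. *)
Definition apery_mem : pred nat := fun s => S s && ((s < m)%N || ~~ S (s - m)%N).

Let m_gt0 : (0 < m)%N. Proof. by case: multS. Qed.
Let Sm : S m. Proof. by case: multS. Qed.
Let S0 : S 0%N. Proof. by case: semiS. Qed.
Let SD a b : S a -> S b -> S (a + b)%N. Proof. by case: semiS => _ + _; apply. Qed.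

Lemma semigroup_mulnl q : S (q * m)%N.
Proof. by elim: q => // q IH; rewrite mulSn SD. Qed.

Lemma apery_memP i s : apery_elem S m i s <-> apery_mem s /\ (s = i %[mod m])%N.
Proof.
split=> [[Ss si sm]|[/andP[Ss sm] si]].
  by split=> //; rewrite /apery_mem Ss; case: sm => ->; rewrite ?orbT.
by split=> //; apply/orP.
Qed.

(** If [a - m] were in [S], then so would be [a + b - m]. *)
Lemma apery_mem_summand a b : S a -> S b -> apery_mem (a + b)%N -> apery_mem a.
Proof.
move=> Sa Sb /andP[_]; rewrite /apery_mem Sa /=; case: (ltnP a m) => //= ma.
rewrite ltnNge (leq_trans ma (leq_addr _ _)) /=; apply: contraNN => Sam.
by rewrite -addnBAC // SD.
Qed.

(** If the larger one exceeds the other by a positive multiple of [m], then subtracting [m] from it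
    leaves an element of [S]. *)
Lemma apery_mem_inj a b : apery_mem a -> apery_mem b -> (a = b %[mod m])%N -> a = b.
Proof.
wlog lt_ab : a b / (a <= b)%N.
  by move=> H ap_a ap_b ab; case: (leqP a b) => [|/ltnW] ?; [|symmetry]; exact: H.
move=> /andP[Sa _] /andP[_ ap_b] /esym/eqP; rewrite eqn_mod_dvd // => /dvdnP[[|q] def_q].
  by apply/eqP; rewrite eqn_leq lt_ab -subn_eq0 def_q.
have def_b : b = (q * m + a + m)%N by move: def_q; rewrite mulSn; lia.
move: ap_b; rewrite def_b addnK ltnNge leq_addl /= => /negP[].
exact: SD (semigroup_mulnl q) Sa.
Qed.

Lemma apery_mem_ltm s : S s -> (s < m)%N -> apery_mem s.
Proof. by rewrite /apery_mem => -> ->. Qed.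

Variable a : 'I_m -> nat.
Hypothesis aP : apery_vec S a.

Lemma apery_vec_mem i : apery_mem (a i).
Proof. by case/apery_memP: (aP i). Qed.

Lemma apery_vec_mod i : (a i %% m)%N = i.
Proof. by case: (aP i) => _ -> _; rewrite modn_small. Qed.

Lemma apery_vec_S i : S (a i).
Proof. by case/andP: (apery_vec_mem i). Qed.

Definition residue s : 'I_m := Ordinal (ltn_pmod s m_gt0).

Lemma apery_mem_residue s : apery_mem s -> s = a (residue s).
Proof.
move=> ap_s; apply: apery_mem_inj (apery_vec_mem _) _ => //.
by rewrite apery_vec_mod.
Qed.

Lemma apery_vec_eq0 (i : 'I_m) : (a i == 0%N) = ((i : nat) == 0%N).
Proof.
apply/eqP/eqP => [ai0|i0]; first by rewrite -(apery_vec_mod i) ai0 mod0n.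
apply: apery_mem_inj (apery_vec_mem _) (apery_mem_ltm S0 m_gt0) _.
by rewrite apery_vec_mod i0 mod0n.
Qed.

Lemma apery_mem_m : ~~ apery_mem m.
Proof. by rewrite /apery_mem subnn S0 ltnn andbF. Qed.

(** The map [e] selects the variables of the ring: the identity gives the Apéry ideal, an
    enumeration of [gen_vars] the defining ideal. *)
Variables (n : nat) (e : 'I_n -> 'I_m).
Local Notation w := (fun j => apery_weights a (e j)).

Lemma apery_weights_S j : S (apery_weights a j).
Proof. by rewrite /apery_weights; case: ifP => // _; exact: apery_vec_S. Qed.

Lemma apery_weights_gt0 j : (0 < apery_weights a j)%N.
Proof.
rewrite /apery_weights; case: ifP => // j0.
by rewrite lt0n apery_vec_eq0 j0.
Qed.

Lemma wdeg_S u : S (wdeg w u).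
Proof.
rewrite /wdeg; elim/big_ind: _ => // j _; elim: (u j) => [|q IH].
  by rewrite muln0.
by rewrite mulnS SD // apery_weights_S.
Qed.

(** Strong induction on [s]: outside the Apéry set split off [m], an atom is the weight of its own
    variable, and any other element is a sum of two smaller ones. *)
Lemma semigroup_wdeg s :
  (exists i0, e i0 = 0%N :> nat) ->
  (forall i : 'I_m, (i : nat) != 0%N -> atomb S (a i) -> exists j, e j = i) ->
  S s -> exists u, wdeg w u = s.
Proof.
move=> [i0 ei0] atoms; elim/ltn_ind: s => s IH Ss.
have [->|s_neq0] := eqVneq s 0%N; first by exists 0%MM; rewrite wdeg0.
have [ap_s|] := boolP (apery_mem s); last first.
  rewrite /apery_mem Ss /= negb_or negbK -leqNgt => /andP[ms Ssm].
  have [|u um] := IH (s - m)%N _ Ssm; first by move: m_gt0; lia.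
  by exists (u + U_(i0))%MM; rewrite wdegD wdegU um /apery_weights ei0 eqxx subnK.
have def_s := apery_mem_residue ap_s.
have r0 : (residue s : nat) != 0%N by rewrite -apery_vec_eq0 -def_s.
have [at_s|] := boolP (atomb S s).
  have [|j ej] := atoms _ r0; first by rewrite -def_s.
  by exists U_(j)%MM; rewrite wdegU ej /apery_weights (negPf r0).
rewrite /atomb Ss lt0n s_neq0 /= negbK => /existsP[b /and3P[b_gt0 Sb Ssb]].
have [u ub] := IH b (ltn_ord b) Sb.
have [|v vb] := IH (s - b)%N _ Ssb; first by move: (ltn_ord b); lia.
by exists (u + v)%MM; rewrite wdegD ub vb subnKC // ltnW.
Qed.

End Apery.

(** * Faces of the Kunz cone *)

Lemma mnm_ind n (P : 'X_{1..n} -> Prop) :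
  P 0%MM -> (forall u i, P u -> P (u + U_(i))%MM) -> forall u, P u.
Proof.
move=> P0 PU u; have [d] := ubnP (mdeg u); elim: d u => // d IH u le_u.
case: (pickP (fun i => u i != 0%N)) => [i ui|u0].
  have /submK def_u : (U_(i) <= u)%MM by rewrite lep1mP.
  rewrite -def_u; apply/PU/IH; move: le_u.
  by rewrite -{1}def_u mdegD mdeg1 addn1.
suff -> : u = 0%MM by [].
by apply/mnmP => i; rewrite mnm0E; apply/eqP; rewrite -[_ == _]negbK u0.
Qed.

(** The combinatorial content of the face: which Kunz inequalities are equalities. For Apéry vectors
    the equation itself forces [l] to be [i + j] modulo [m]. *)
Definition sums_transfer m (a b : 'I_m -> nat) : Prop :=
  forall i j l, (a i + a j = a l -> b i + b j = b l)%N.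

Section Transfer.
Variables (S T : pred nat) (m : nat) (a b : 'I_m -> nat).
Hypotheses (semiS : numerical_semigroup S) (multS : multiplicity S m).
Hypotheses (aP : apery_vec S a).
Hypotheses (semiT : numerical_semigroup T) (multT : multiplicity T m).
Hypotheses (bP : apery_vec T b).
Hypothesis ab : sums_transfer a b.

(** Every factor of a monomial of Apéry weight again has Apéry weight. So the variable of weight [m]
    cannot occur, and adjoining one variable at a time uses only equalities between Apéry
    elements. *)
Lemma wdeg_transfer n (e : 'I_n -> 'I_m) u l :
  wdeg (fun j => apery_weights a (e j)) u = a l ->
  wdeg (fun j => apery_weights b (e j)) u = b l.
Proof.
elim/mnm_ind: u l => [|u j IH] l.
  rewrite !wdeg0 => /esym/eqP; rewrite (apery_vec_eq0 semiS multS aP).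
  by rewrite -(apery_vec_eq0 semiT multT bP) => /eqP.
rewrite !wdegD !wdegU => ujl.
have ap_l := apery_vec_mem aP l; rewrite -ujl in ap_l.
have Su := wdeg_S semiS multS aP e u.
have Sj := apery_weights_S multS aP (e j).
have /(apery_mem_residue semiS multS aP) def_u := apery_mem_summand semiS Su Sj ap_l.
have ap_j : apery_mem S m (apery_weights a (e j)).
  by apply: (apery_mem_summand semiS Sj Su); rewrite addnC.
rewrite (IH _ def_u); rewrite def_u in ujl.
move: (residue _ _) ujl ap_j => r; rewrite /apery_weights; case: ifP => _ ujl ap_j.
  by have := apery_mem_m m semiS; rewrite ap_j.
exact: ab.
Qed.

(** A decomposition of [a l] in [S] has Apéry summands, so [ab] carries it over to a decomposition
    of [b l]. *)
Lemma atomb_transfer (l : 'I_m) : atomb T (b l) -> atomb S (a l).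
Proof.
rewrite /atomb => /and3P[_ bl0 /negP not_sum].
rewrite (apery_vec_S aP) lt0n (apery_vec_eq0 semiS multS aP).
rewrite -(apery_vec_eq0 semiT multT bP) -lt0n bl0 /=.
apply/negP => /existsP[s /and3P[s0 Ss Sls]]; apply: not_sum.
have ap_l := apery_vec_mem aP l.
have sl := ltn_ord s; rewrite -(subnKC (ltnW sl)) in ap_l.
have def_s := apery_mem_residue semiS multS aP (apery_mem_summand semiS Ss Sls ap_l).
rewrite addnC in ap_l.
have def_t := apery_mem_residue semiS multS aP (apery_mem_summand semiS Sls Ss ap_l).
have /ab bl : (a (residue multS s) + a (residue multS (a l - s)%N) = a l)%N.
  by rewrite -def_s -def_t subnKC // ltnW.
have r0 : (0 < b (residue multS s))%N.
  rewrite lt0n (apery_vec_eq0 semiT multT bP) -(apery_vec_eq0 semiS multS aP).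
  by rewrite -def_s -lt0n.
have t0 : (0 < b (residue multS (a l - s)%N))%N.
  rewrite lt0n (apery_vec_eq0 semiT multT bP) -(apery_vec_eq0 semiS multS aP).
  by rewrite -def_t -lt0n subn_gt0.
have lt_bl : (b (residue multS s) < b l)%N by rewrite -bl -addn1 leq_add2l.
apply/existsP; exists (Ordinal lt_bl) => /=.
by rewrite r0 (apery_vec_S bP) -bl addKn (apery_vec_S bP).
Qed.

End Transfer.

(** The surviving monomials are those of Apéry weight. For any other, the weight minus [m] is still
    in [T], and is the weight of a monomial since all atoms of [T] are available. *)
Lemma toric_apery_sub (k : fieldType) (S T : pred nat) m (a b : 'I_m -> nat)
    n (e : 'I_n -> 'I_m) (i0 : 'I_n) :
  numerical_semigroup S -> multiplicity S m -> apery_vec S a ->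
  numerical_semigroup T -> multiplicity T m -> apery_vec T b ->
  sums_transfer a b -> sums_transfer b a -> e i0 = 0%N :> nat ->
  (forall i : 'I_m, (i : nat) != 0%N -> atomb T (b i) -> exists j, e j = i) ->
  forall p, p \in @toric_ideal k n (fun j => apery_weights a (e j)) ->
    exists2 q, q \in @toric_ideal k n (fun j => apery_weights b (e j)) &
      exists c, p = q + 'X_i0 * c.
Proof.
move=> semiS multS aP semiT multT bP ab ba ei0 atoms.
have Tw u := wdeg_S semiT multT bP e u.
apply: (@toric_sub_modX _ _ _ _ i0
  (fun u => apery_mem T m (wdeg (fun j => apery_weights b (e j)) u))) => u.
- rewrite /apery_mem Tw /= negb_or negbK -leqNgt => /andP[mu Tum].
  have [|v vP] := semigroup_wdeg semiT multT bP _ atoms Tum; first by exists i0.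
  by exists v; rewrite vP /apery_weights ei0 eqxx subnKC.
- move=> v ap_u; have bu := apery_mem_residue semiT multT bP ap_u.
  have au := wdeg_transfer semiT multT bP semiS multS aP ba bu.
  rewrite bu au; apply/eqP/eqP => [bv|av].
    exact (wdeg_transfer semiT multT bP semiS multS aP ba bv).
  exact (wdeg_transfer semiS multS aP semiT multT bP ab av).
- by move=> v ap_u ->.
Qed.

Section Faces.
Variables (R : realType) (m : nat).

Lemma zat_ord (z : 'I_m -> R) l (lm : (l %% m < m)%N) : zat z l = z (Ordinal lm).
Proof. by rewrite /zat insubT. Qed.

(** The segment from [y] to [x] can be prolonged beyond [x] inside [F]: the new point is the affine
    combination with coefficients [1 + t] and [- t]. *)
Lemma rel_interior_extend (F : ('I_m -> R) -> Prop) x y :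
  rel_interior F x -> F y ->
  exists2 t : R, 0 < t & F (fun i => x i + t * (x i - y i)).
Proof.
move=> [Fx [eps eps_gt0 near]] Fy.
(* This exceeds every coordinate difference strictly, and stays positive when [x] and [y] agree. *)
pose s := 1 + \sum_i `|x i - y i|.
have s_gt0 : 0 < s by rewrite ltr_wpDr // sumr_ge0.
exists (eps / s); first by rewrite divr_gt0.
apply: near => [|i].
  exists 2, (fun j : 'I_2 => if j == 0 then 1 + eps / s else - (eps / s)),
    (fun j : 'I_2 => if j == 0 then x else y); split.
  - by move=> j; case: ifP.
  - by rewrite big_ord_recr big_ord1 /= addrK.
  - by move=> i; rewrite big_ord_recr big_ord1 /= mulrDl mul1r mulNr mulrBr addrA.
rewrite addrC addKr normrM gtr0_norm ?divr_gt0 // mulrAC ltr_pdivrMr //.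
rewrite ltr_pM2l // /s (bigD1 i) //= ltr_pwDl // lerDl.
by rewrite sumr_ge0.
Qed.

(** The slack [z i + z j - z l] is linear and vanishes at [x]. Were it positive at [y], it would be
    negative just beyond [x], at a point still in the cone. *)
Lemma rel_interior_tight (F : ('I_m -> R) -> Prop) x y (i j l : 'I_m) :
  is_face (@kunz_cone R m) F -> rel_interior F x -> rel_interior F y ->
  (0 < i)%N -> (0 < j)%N -> (l : nat) = ((i + j) %% m)%N -> (0 < l)%N ->
  x i + x j = x l -> y i + y j = y l.
Proof.
move=> [c [_ Fc]] relx rely i0 j0 def_l l0.
wlog le_ij : i j i0 j0 def_l / (i <= j)%N.
  move=> H; case: (leqP i j) => [|/ltnW] ij; first exact: H.
  by rewrite addrC => xl; rewrite addrC; apply: H; rewrite // addnC.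
have lz (z : 'I_m -> R) : zat z (i + j)%N = z l.
  have lm : ((i + j) %% m < m)%N by rewrite -def_l.
  by rewrite zat_ord; congr z; apply: val_inj.
have cone (z : 'I_m -> R) : kunz_cone z -> z l <= z i + z j.
  by move=> [_ _ /(_ i j i0 le_ij)]; rewrite lz -def_l -lt0n => /(_ l0).
move=> xl; have [Fy _] := rely; have /Fc[/cone yl _] := Fy.
have [t t_gt0 /Fc[/cone]] := rel_interior_extend relx Fy.
rewrite addrACA xl -mulrDr => + _.
rewrite lerD2l ler_pM2l // addrACA xl lerD2l -opprD lerN2 => yl'.
by apply/eqP; rewrite eq_le yl' yl.
Qed.

End Faces.

Lemma face_sums_transfer (R : realType) m (S T : pred nat) (a b : 'I_m -> nat) F :
  numerical_semigroup S -> multiplicity S m -> apery_vec S a ->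
  numerical_semigroup T -> multiplicity T m -> apery_vec T b ->
  is_face (@kunz_cone R m) F ->
  rel_interior F (apery_point R a) -> rel_interior F (apery_point R b) ->
  sums_transfer a b.
Proof.
move=> semiS multS aP semiT multT bP faceF Fa Fb i j l.
have a0 := apery_vec_eq0 semiS multS aP; have b0 := apery_vec_eq0 semiT multT bP.
have a_inj i1 i2 : a i1 = a i2 -> i1 = i2.
  move=> eq_a; apply: ord_inj.
  by rewrite -(apery_vec_mod aP i1) eq_a (apery_vec_mod aP).
move=> sum_a.
(* The Kunz inequalities concern nonzero indices only; with a zero index the relation just
   identifies the other index with [l]. *)
have [i0|i0] := eqVneq (i : nat) 0%N.
  have /eqP ai : a i == 0%N by rewrite a0 i0.
  have /eqP-> : b i == 0%N by rewrite b0 i0.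
  by move: sum_a; rewrite ai => /a_inj->.
have [j0|j0] := eqVneq (j : nat) 0%N.
  have /eqP aj : a j == 0%N by rewrite a0 j0.
  have /eqP-> : b j == 0%N by rewrite b0 j0.
  by move: sum_a; rewrite aj !addn0 => /a_inj->.
have l0 : (0 < l)%N.
  by rewrite lt0n -a0 -sum_a addn_eq0 negb_and a0 i0.
apply/eqP; rewrite -(eqr_nat R) natrD; apply/eqP.
apply: (rel_interior_tight faceF Fa Fb) => //; rewrite ?lt0n //.
  by rewrite -(apery_vec_mod aP l) -sum_a -modnDm !(apery_vec_mod aP).
by rewrite /apery_point -natrD sum_a.
Qed.

(** * Ranks of complexes exact modulo an element *)

(** With an explicit witness, all matrices stay over [A] and no quotient ring is formed. *)
Definition eqmod_mx (A : comNzRingType) (x : A) m n (U V : 'M[A]_(m, n)) : Prop :=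
  exists W, U = V + x *: W.

Definition exact_mod (A : comNzRingType) (x : A) (r : nat -> nat)
    (D : forall d, 'M[A]_(r d.+1, r d)) : Prop :=
  forall d, eqmod_mx x (D d.+1 *m D d) 0 /\
    forall u : 'rV_(r d.+1), eqmod_mx x (u *m D d) 0 ->
      exists v, eqmod_mx x u (v *m D d.+1).

Section Comparison.
Variables (A : comNzRingType) (x : A).

Lemma eqmod_mx_rows m n p (U : 'M[A]_(m, p)) (D : 'M_(n, p)) :
  (forall i, exists v : 'rV_n, eqmod_mx x (row i U) (v *m D)) ->
  exists V : 'M_(m, n), eqmod_mx x U (V *m D).
Proof.
move=> /fin_all_exists[v /fin_all_exists[w uvw]].
exists (\matrix_i v i), (\matrix_i w i); apply/row_matrixP => i.
by rewrite uvw linearD /= row_mul rowK linearZ /= rowK.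
Qed.

Lemma exact_mod_mx r D d m (U : 'M[A]_(m, r d.+1)) :
  exact_mod x D -> eqmod_mx x (U *m D d) 0 ->
  exists V, eqmod_mx x U (V *m D d.+1).
Proof.
move=> exD [W UW]; apply: eqmod_mx_rows => i.
apply: (exD d).2; exists (row i W).
by rewrite -row_mul UW !add0r linearZ.
Qed.

(* The last condition stands for [f *m g - 1 = h *m D d + D d.-1 *m h'], composed
   on the left with [D d] so that degree [d.-1] does not occur. *)
Definition homotopic_pair r s (D : forall d, 'M[A]_(r d.+1, r d))
    (E : forall d, 'M[A]_(s d.+1, s d)) d
    (f : 'M_(r d, s d)) (g : 'M_(s d, r d)) : Prop :=
  [/\ exists f', eqmod_mx x (D d *m f) (f' *m E d),
      exists g', eqmod_mx x (E d *m g) (g' *m D d) &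
      exists h, eqmod_mx x (D d *m (f *m g - 1%:M - h *m D d)) 0].

Variables (k : fieldType) (eps : {rmorphism A -> k}).
Hypothesis eps_x : eps x = 0.

(** Exactness lifts [f] and [g] one degree up. The rows of [f' *m g' - 1%:M - D d *m h] are cycles
    modulo [x], hence boundaries, which gives the next homotopy [H]. Applying [eps] kills [x] and
    the differentials, leaving the identity. *)
Lemma homotopic_pairS r s (D : forall d, 'M[A]_(r d.+1, r d))
    (E : forall d, 'M[A]_(s d.+1, s d)) d f g :
  (forall d, map_mx eps (D d) = 0) ->
  exact_mod x D -> exact_mod x E -> @homotopic_pair r s D E d f g ->
  exists f' g', @homotopic_pair r s D E d.+1 f' g' /\
    map_mx eps f' *m map_mx eps g' = 1%:M.
Proof.
move=> D0 exD exE [[f' [W1 Df]] [g' [W2 Eg]] [h [W3 Dh]]].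
have [W5 DD] := (exD d).1; have [W6 EE] := (exE d).1.
move: DD EE Dh; rewrite !add0r => DD EE Dh.
have f'E : f' *m E d = D d *m f - x *: W1 by rewrite Df addrK.
have g'D : g' *m D d = E d *m g - x *: W2 by rewrite Eg addrK.
have [H [W4 defH]] : exists H, eqmod_mx x (f' *m g' - 1%:M - D d *m h) (H *m D d.+1).
  apply: exact_mod_mx => //.
  exists (W3 - W1 *m g - f' *m W2); rewrite add0r !scalerBr -Dh.
  rewrite !mulmxBl -mulmxA g'D mulmxBr mulmxA f'E mulmxBl mul1mx.
  rewrite -!scalemxAr -!scalemxAl !mulmxBr mulmx1 !mulmxA.
  by rewrite [LHS](ACl (1*4*5*2*3)%AC).
exists f', g'; split.
  split.
  - apply: exact_mod_mx => //; exists (W5 *m f - D d.+1 *m W1).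
    by rewrite -mulmxA f'E mulmxBr mulmxA DD -!scalemxAr -!scalemxAl add0r scalerBr.
  - apply: exact_mod_mx => //; exists (W6 *m g - E d.+1 *m W2).
    by rewrite -mulmxA g'D mulmxBr mulmxA EE -!scalemxAr -!scalemxAl add0r scalerBr.
  - exists H, (W5 *m h + D d.+1 *m W4).
    have -> : f' *m g' - 1%:M - H *m D d.+1 = D d *m h + x *: W4.
      by apply/eqP; rewrite subr_eq addrAC -addrA -defH addrC subrK.
    by rewrite mulmxDr mulmxA DD -!scalemxAr -!scalemxAl add0r scalerDr.
rewrite -map_mxM.
have -> : f' *m g' = 1%:M + D d *m h + (H *m D d.+1 + x *: W4).
  by rewrite -defH -[X in _ + X]addrA -opprD [RHS]addrC subrK.
rewrite !map_mxD !map_mxM !D0 mul0mx mulmx0 map_mxZ eps_x scale0r !addr0.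
exact: map_mx1.
Qed.

(** A factorization of the identity over a field through dimension [s d.+1] bounds [r d.+1]. *)
Lemma exact_mod_rank_le r s (D : forall d, 'M[A]_(r d.+1, r d))
    (E : forall d, 'M[A]_(s d.+1, s d)) f g d :
  (forall d, map_mx eps (D d) = 0) ->
  exact_mod x D -> exact_mod x E -> @homotopic_pair r s D E 0 f g ->
  (r d.+1 <= s d.+1)%N.
Proof.
move=> D0 exD exE fg.
suff [f' [g' [_ /mulmx1_min]]] : exists f' g', @homotopic_pair r s D E d.+1 f' g' /\
    map_mx eps f' *m map_mx eps g' = 1%:M by [].
elim: d => [|d [f' [g' [fg' _]]]]; first exact: homotopic_pairS fg.
exact: homotopic_pairS fg'.
Qed.

End Comparison.

(** * Resolutions of ideals modulo a nonzerodivisor *)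

Section AugmentedComplex.
Variables (k : fieldType) (n : nat).
Local Notation A := {mpoly k[n]}.

(** The ring itself is placed in degree 0, so that the augmentation becomes one more differential
    and every other degree shifts by one. *)
Definition aug_rank (rk : nat -> nat) d : nat := if d is e.+1 then rk e else 1.

Definition aug_dif rk (aug : 'M[A]_(rk 0%N, 1)) (dif : forall d, 'M[A]_(rk d.+1, rk d))
    d : 'M[A]_(aug_rank rk d.+1, aug_rank rk d) :=
  match d with 0 => aug | e.+1 => dif e end.

Variables (w : 'I_n -> nat) (I : pred A) (rk : nat -> nat).
Variables (gdeg : forall d, 'I_(rk d) -> nat).
Variables (aug : 'M[A]_(rk 0%N, 1)) (dif : forall d, 'M[A]_(rk d.+1, rk d)).
Hypothesis res : min_graded_free_res w I gdeg aug dif.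

Lemma aug_dif_coef0 d : map_mx (mcoeff 0%MM) (aug_dif aug dif d) = 0.
Proof.
case: res => _ _ [aug0 dif0] _ _; apply/matrixP => i j.
by case: d i j => [|d] i j; rewrite !mxE /= ?ord1 ?aug0 ?dif0.
Qed.

(** If [u] maps to [x *: y], then [y] is itself a boundary [v *m D]: in degree 0 because [x] cancels
    modulo [I], higher up because [x] cancels in the ring. Then [u - x *: v] is a true cycle. *)
Lemma aug_dif_exact_mod (x : A) :
  x != 0 -> (forall p, x * p \in I -> p \in I) -> exact_mod x (aug_dif aug dif).
Proof.
case: res => _ _ _ augI [exact0 exactS] x0 nzI.
have complex d : aug_dif aug dif d.+1 *m aug_dif aug dif d = 0.
  apply/row_matrixP => i; rewrite row_mul row0.
  case: d i => [|d] i.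
    by apply/exact0; exists (delta_mx 0 i); rewrite /= -rowE.
  by apply/exactS; exists (delta_mx 0 i); rewrite /= -rowE.
have exact d (u : 'rV_(aug_rank rk d.+1)) :
    u *m aug_dif aug dif d = 0 -> exists v, u = v *m aug_dif aug dif d.+1.
  by case: d u => [|d] u /= => [/exact0|/exactS].
have lift d (y : 'rV_(aug_rank rk d)) (u : 'rV_(aug_rank rk d.+1)) :
    u *m aug_dif aug dif d = x *: y -> exists v, y = v *m aug_dif aug dif d.
  case: d y u => [|d] y u uy.
    have /augI[v vy] : y 0 0 \in I.
      by apply: nzI; apply/augI; exists u; rewrite [_ *m _]uy mxE.
    by exists v; apply/rowP => j; rewrite !ord1 -vy.
  apply: exact; apply/eqP; have := congr1 (mulmxr (aug_dif aug dif d)) uy.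
  rewrite /= -mulmxA complex mulmx0 -scalemxAl => /esym/eqP.
  by rewrite scalemx_eq0 (negPf x0).
move=> d; split; first by exists 0; rewrite complex scaler0 addr0.
move=> u [y]; rewrite add0r => uy; have [v def_y] := lift _ _ _ uy.
have [|v' def_u] := exact d (u - x *: v).
  by rewrite mulmxBl uy -scalemxAl def_y subrr.
by exists v', v; rewrite -def_u subrK.
Qed.

End AugmentedComplex.

(** The comparison starts from the identity of the ring in degree 0, with zero homotopy; it lifts
    one step since each generator of one ideal is congruent to an element of the other. The weights
    [w1] and [w2] may differ. *)
Lemma resolution_rank_le (k : fieldType) n (x : {mpoly k[n]})
    w1 (I1 : pred {mpoly k[n]}) rk1 gdeg1 aug1 dif1
    w2 (I2 : pred {mpoly k[n]}) rk2 gdeg2 aug2 dif2 d :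
  @min_graded_free_res k n w1 I1 rk1 gdeg1 aug1 dif1 ->
  @min_graded_free_res k n w2 I2 rk2 gdeg2 aug2 dif2 ->
  x != 0 -> x@_0%MM = 0 ->
  (forall p, x * p \in I1 -> p \in I1) -> (forall p, x * p \in I2 -> p \in I2) ->
  (forall p, p \in I1 -> exists2 q, q \in I2 & exists c, p = q + x * c) ->
  (forall p, p \in I2 -> exists2 q, q \in I1 & exists c, p = q + x * c) ->
  (rk1 d <= rk2 d)%N.
Proof.
move=> res1 res2 x0 x_0 nz1 nz2 I12 I21.
have half w I rk gdeg (aug : 'M_(rk 0%N, 1)) dif (I' : pred {mpoly k[n]})
    m (B : 'M_(m, 1)) :
    @min_graded_free_res k n w I rk gdeg aug dif ->
    (forall p, p \in I' <-> exists v : 'rV_m, (v *m B) ord0 ord0 = p) ->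
    (forall p, p \in I -> exists2 q, q \in I' & exists c, p = q + x * c) ->
    exists f', eqmod_mx x (aug *m 1%:M) (f' *m B).
  case=> _ _ _ augI _ BI' II'; rewrite mulmx1; apply: eqmod_mx_rows => i.
  have /II'[q /BI'[v <-] [c augc]] : aug i 0 \in I.
    by apply/augI; exists (delta_mx 0 i); rewrite -rowE mxE.
  by exists v, c%:M; apply/rowP => j; rewrite ord1 !mxE augc !mxE eqxx mulr1n.
apply: (@exact_mod_rank_le _ x k (mcoeff 0%MM) x_0 _ _
  (aug_dif aug1 dif1) (aug_dif aug2 dif2) 1%:M 1%:M d).
- exact: aug_dif_coef0 res1.
- exact: aug_dif_exact_mod res1 _ x0 nz1.
- exact: aug_dif_exact_mod res2 _ x0 nz2.
split=> /=.
- by apply: half res1 _ I12; case: res2.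
- by apply: half res2 _ I21; case: res1.
- by exists 0, 0; rewrite mul0mx subr0 mulmx1 subrr mulmx0 scaler0 addr0.
Qed.

(** * Existence of minimal graded free resolutions *)

Section Homogeneous.
Variables (k : fieldType) (n : nat) (w : 'I_n -> nat).
Local Notation A := {mpoly k[n]}.

(** The shift [s] is the degree of the basis vector that [p] multiplies. *)
Definition component (s e : nat) (p : A) : A :=
  \sum_(u <- msupp p | (wdeg w u + s == e)%N) p@_u *: 'X_[u].

Lemma mcoeff_component s e p u :
  (component s e p)@_u = if (wdeg w u + s == e)%N then p@_u else 0.
Proof.
have coef_sum (P Q : pred 'X_{1..n}) : (forall v, P v -> ~~ Q v) -> Q u ->
    (\sum_(v <- msupp p | P v) p@_v *: 'X_[v])@_u = 0.
  move=> PQ Qu; rewrite raddf_sum /= big1 // => v /PQ Qv.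
  by rewrite mcoeffZ mcoeffX; case: eqP Qv => [->|_]; rewrite ?Qu ?mulr0.
case: ifPn => ue; last first.
  by apply: (coef_sum _ (fun v => (wdeg w v + s != e)%N)) => // v ->.
rewrite [in RHS](mpolyE p) [in RHS](bigID (fun v => (wdeg w v + s == e)%N)) /= mcoeffD.
by rewrite [X in _ + X](coef_sum _ (fun v => (wdeg w v + s == e)%N)) ?addr0.
Qed.

Lemma component0 s e : component s e 0 = 0.
Proof. by apply/mpolyP => u; rewrite mcoeff_component mcoeff0 if_same. Qed.

Lemma componentD s e : {morph component s e : p q / p + q}.
Proof.
move=> p q; apply/mpolyP => u; rewrite mcoeffD !mcoeff_component mcoeffD.
by case: ifP; rewrite ?addr0.
Qed.

Lemma component_supp s e p u :
  u \in msupp (component s e p) -> (wdeg w u + s = e)%N.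
Proof. by rewrite mcoeff_msupp mcoeff_component; case: ifP => [/eqP|]; rewrite ?eqxx. Qed.

(** Multiplication by the homogeneous [q] sends the part of [p] in degree [e] to degree [e], and all
    the rest to other degrees. *)
Lemma componentM s d e p q :
  (forall u, u \in msupp q -> (wdeg w u + s = d)%N) ->
  component s e (p * q) = component d e p * q.
Proof.
move=> qd; have split_p : p = component d e p + (p - component d e p).
  by rewrite addrC subrK.
have supp_q u f : u \in msupp (f * q) ->
    exists2 v, v \in msupp f & (wdeg w u + s = wdeg w v + d)%N.
  move=> /msuppM_le/allpairsP[[v v'] /= [vf v'q ->]].
  by exists v; rewrite // wdegD -addnA (qd v').
rewrite {1}split_p mulrDl componentD -[RHS]addr0; congr (_ + _); apply/mpolyP => u.
  rewrite mcoeff_component; case: ifPn => // ue; apply/esym/eqP.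
  rewrite mcoeff_eq0; apply: contraNN ue => /supp_q[v /component_supp ve ->].
  exact/eqP.
rewrite mcoeff_component mcoeff0; case: ifPn => // /eqP ue; apply/eqP.
rewrite mcoeff_eq0; apply/negP => /supp_q[v]; rewrite ue => + ev.
by rewrite mcoeff_msupp mcoeffB mcoeff_component -ev eqxx subrr eqxx.
Qed.

Definition row_component r (g : 'I_r -> nat) e (u : 'rV[A]_r) : 'rV[A]_r :=
  \row_i component (g i) e (u 0 i).

(** The additive form avoids truncated subtraction: an entry is automatically zero when
    [g j < h i]. *)
Definition homog_mx r q (g : 'I_r -> nat) (h : 'I_q -> nat) (D : 'M[A]_(r, q)) : Prop :=
  forall j i u, u \in msupp (D j i) -> (wdeg w u + h i = g j)%N.

Lemma row_component_mul r q g h (D : 'M[A]_(r, q)) e u :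
  homog_mx g h D -> row_component h e (u *m D) = row_component g e u *m D.
Proof.
move=> homD; apply/rowP => i; rewrite !mxE.
rewrite (big_morph _ (componentD (h i) e) (component0 (h i) e)).
by apply: eq_bigr => j _; rewrite !mxE; apply: componentM => v /homD.
Qed.

Lemma row_component_sum r (g : 'I_r -> nat) (u : 'rV[A]_r) :
  exists B, u = \sum_(e < B) row_component g e u.
Proof.
pose B := (\max_i \max_(v <- msupp (u 0%R i)) (wdeg w v + g i)).+1; exists B.
apply/rowP => i; rewrite summxE; apply/mpolyP => v; rewrite raddf_sum /=.
under eq_bigr do rewrite mxE mcoeff_component.
have [vu|/memN_msupp_eq0 v0] := boolP (v \in msupp (u 0 i)); last first.
  by rewrite v0 big1 // => e _; rewrite if_same.
have vB : (wdeg w v + g i < B)%N.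
  rewrite ltnS (leq_trans _ (leq_bigmax i)) //.
  exact: (@leq_bigmax_seq _ _ xpredT (fun v => wdeg w v + g i)%N).
rewrite (bigD1 (Ordinal vB)) //= eqxx big1 ?addr0 // => e.
by rewrite -val_eqE /= eq_sym => /negPf->.
Qed.

Definition graded_submodule r (g : 'I_r -> nat) (K : 'rV[A]_r -> Prop) : Prop :=
  submodule K /\ forall e u, K u -> K (row_component g e u).

Lemma graded_submodule_ker r q g h (D : 'M[A]_(r, q)) :
  homog_mx g h D -> graded_submodule g (fun u => u *m D = 0).
Proof.
move=> homD; split=> [|e u uD].
  by split=> [|c u v uD vD]; rewrite ?mul0mx // mulmxDl -scalemxAl uD vD scaler0 addr0.
rewrite -(row_component_mul _ _ homD) uD; apply/rowP => i.
by rewrite !mxE component0.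
Qed.

(** Replace finitely many generators by their homogeneous components, which stay in [K] and are
    finite in number. *)
Lemma homogeneous_generators r (g : 'I_r -> nat) K : graded_submodule g K ->
  exists N h (D : 'M[A]_(N, r)), homog_mx h g D /\
    forall u, K u <-> exists v, u = v *m D.
Proof.
move=> [subK compK]; have [s [sK Ks]] := noetherian_rV (@noetherian_mpoly k n) subK.
have {sK} [t [tK tH ts]] : exists t : seq 'rV[A]_r, [/\ forall x, x \in t -> K x,
    forall x, x \in t -> exists e, forall i v,
      v \in msupp (x 0 i) -> (wdeg w v + g i = e)%N &
    forall x, x \in s -> spanned t x].
  elim: s sK {Ks} => [|x s IH] sK; first by exists [::].
  have [|t [tK tH ts]] := IH; first by move=> y ys; apply: sK; rewrite inE ys orbT.
  have [B def_x] := row_component_sum g x.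
  pose tx := [seq row_component g e x | e <- iota 0 B].
  exists (tx ++ t); split=> y.
  - rewrite mem_cat => /orP[/mapP[e _ ->]|/tK//].
    by apply: compK; apply: sK; rewrite mem_head.
  - rewrite mem_cat => /orP[/mapP[e _ ->]|/tH//].
    by exists e => i v; rewrite mxE => /component_supp.
  - rewrite inE => /predU1P[->|/ts]; last first.
      by apply: spanned_sub => z zt; rewrite mem_cat zt orbT.
    rewrite def_x; apply: spanned_sum => e; apply: spanned_mem.
    rewrite mem_cat; apply/orP; left; apply/mapP.
    by exists (e : nat); rewrite // mem_iota /=.
have /fin_all_exists[h hP] (j : 'I_(size t)) : exists e, forall i v,
    v \in msupp (t`_j 0 i) -> (wdeg w v + g i = e)%N.
  by apply: tH; rewrite mem_nth.
pose D := \matrix_(j < size t) t`_j.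
exists (size t), h, D; split=> [j i v|u].
  by rewrite mxE => /hP.
have subD : submodule (fun u => exists v : 'rV_(size t), u = v *m D).
  split=> [|c _ _ [x ->] [y ->]]; first by exists 0; rewrite mul0mx.
  by exists (c *: x + y); rewrite mulmxDl scalemxAl.
have [K0 KZD] := subK; split=> [Ku|[v ->]].
  apply: (spanned_min subD _ (spanned_min (submodule_spanned t) ts (Ks _ Ku))).
  move=> x xt; have lt_x : (index x t < size t)%N by rewrite index_mem.
  by exists (delta_mx 0 (Ordinal lt_x)); rewrite -rowE rowK nth_index.
rewrite mulmx_sum_row; elim/big_ind: _ => // [x y Kx Ky|j _].
  by rewrite -(scale1r x); exact: KZD.
by rewrite -[_ *: _]addr0; apply: KZD => //; rewrite rowK; apply/tK/mem_nth.
Qed.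

(* For homogeneous generators this is minimality: a homogeneous relation with a
   nonzero constant term expresses one generator through the others. *)
Definition minimal_mx r q (g : 'I_r -> nat) (D : 'M[A]_(r, q)) : Prop :=
  forall e (v : 'rV[A]_r), (forall i u, u \in msupp (v 0 i) -> (wdeg w u + g i = e)%N) ->
    v *m D = 0 -> forall j, (v 0 j)@_0%MM = 0.

Hypothesis w_gt0 : forall i, (0 < w i)%N.

Lemma wdeg_eq0 u : wdeg w u = 0%N -> u = 0%MM.
Proof.
move=> /eqP; rewrite /wdeg sum_nat_eq0 => /forallP u0; apply/mnmP => i.
by have := u0 i; rewrite /= muln_eq0 -leqn0 leqNgt w_gt0 /= mnm0E => /eqP.
Qed.

Lemma mulmx_drop_row N r (j : 'I_N.+1) (y : 'rV[A]_N.+1) (D : 'M[A]_(N.+1, r)) :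
  y 0 j = 0 -> y *m D = col' j y *m row' j D.
Proof.
move=> y0; apply/rowP => i; rewrite !mxE (bigD1_ord j) //= y0 mul0r add0r.
by apply: eq_bigr => l _; rewrite !mxE.
Qed.

Lemma minimal_generators r (g : 'I_r -> nat) K : graded_submodule g K ->
  exists N h (D : 'M[A]_(N, r)), [/\ homog_mx h g D, minimal_mx h D &
    forall u, K u <-> exists v, u = v *m D].
Proof.
move=> /homogeneous_generators[N [h [D [homD KD]]]].
elim: N h D homD KD => [|N IH] h D homD KD.
  by exists 0%N, h, D; split=> // e v _ _ [].
have [minD|] := boolp.EM (minimal_mx h D); first by exists N.+1, h, D.
move=> /boolp.existsNP[e /boolp.existsNP[v]] /boolp.not_implyP[homv].
move=> /boolp.not_implyP[vD /boolp.existsNP[j /eqP vj]].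
have v0 : 0%MM \in msupp (v 0 j) by rewrite mcoeff_msupp.
have def_e : h j = e by rewrite -(homv _ _ v0) wdeg0.
have def_vj : v 0 j = ((v 0 j)@_0%MM)%:MP.
  apply/mpolyP => u; rewrite mcoeffC.
  case: eqVneq => [<-|u0]; first by rewrite mulr1.
  rewrite mulr0; apply/eqP; rewrite mcoeff_eq0.
  apply/negP => /homv; rewrite def_e => ue.
  have u_0 : u = 0%MM by apply: wdeg_eq0; lia.
  by rewrite u_0 eqxx in u0.
set c := (v 0 j)@_0%MM in def_vj vj.
apply: (IH (h \o lift j) (row' j D)) => [i i' u|u].
  by rewrite mxE => /homD.
rewrite KD; split=> [[y ->]|[y ->]].
  (* This multiple of the relation [v] clears coordinate [j] without changing the product with
     [D]. *)
  exists (col' j (y - (y 0 j * c^-1%:MP) *: v)).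
  rewrite -mulmx_drop_row ?mulmxBl -?scalemxAl ?vD ?scaler0 ?subr0 //.
  by rewrite !mxE def_vj -mulrA -mpolyCM mulVf // mulr1 subrr.
exists (\row_i oapp (y 0) 0 (unlift j i)).
rewrite (mulmx_drop_row (j := j)); last by rewrite mxE unlift_none.
by congr (_ *m _); apply/rowP => i; rewrite !mxE liftK.
Qed.

Lemma homog_mx_whomog r q g h (D : 'M[A]_(r, q)) : homog_mx g h D -> forall j i,
  whomog w (g j - h i)%N (D j i) /\ ((g j < h i)%N -> D j i = 0).
Proof.
move=> homD j i; split=> [u /homD <-|lt_gh]; first by rewrite addnK.
apply/mpolyP => u; rewrite mcoeff0; apply/eqP; rewrite mcoeff_eq0.
by apply/negP => /homD; lia.
Qed.

(** Bundling ranks and degrees with the matrix gives all differentials one type, so that the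
    construction can be iterated. *)
Record stage := Stage {
  stage_rk : nat; stage_deg : 'I_stage_rk -> nat;
  stage_prev_rk : nat; stage_prev_deg : 'I_stage_prev_rk -> nat;
  stage_mx : 'M[A]_(stage_rk, stage_prev_rk) }.

Definition valid_stage st :=
  homog_mx (@stage_deg st) (@stage_prev_deg st) (stage_mx st) /\
  minimal_mx (@stage_deg st) (stage_mx st).

(** Validity is assumed inside the existential, so a successor can be chosen for every stage. The
    rows of [D] are homogeneous relations between minimal generators, hence have zero constant
    terms. *)
Lemma next_stage st : exists N : {N & (('I_N -> nat) * 'M[A]_(N, stage_rk st))%type},
  let D : 'M[A]_(projT1 N, stage_rk st) := (projT2 N).2 in
  valid_stage st ->
  [/\ valid_stage (Stage (projT2 N).1 (@stage_deg st) D),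
      forall j i, (D j i)@_0%MM = 0 &
      forall u : 'rV_(stage_rk st), u *m stage_mx st = 0 <-> exists v, u = v *m D].
Proof.
have [[homM minM]|] := boolp.EM (valid_stage st); last first.
  (* Dummy successor of an invalid stage. *)
  by move=> notV; exists (existT _ 0%N (fun=> 0%N, 0)) => /= /notV.
have [N [h [D [homD minD kerD]]]] := minimal_generators (graded_submodule_ker homM).
exists (existT _ N (h, D)) => /= _; split=> // j i /=.
have jD : row j D *m stage_mx st = 0.
  by apply/kerD; exists (delta_mx 0 j); rewrite -rowE.
have := minM (h j) (row j D) _ jD i; rewrite mxE; apply=> i' u.
by rewrite mxE => /homD.
Qed.

(** Iterate [next_stage] from minimal homogeneous generators of [I], seen as a submodule of the free
    module of rank 1 generated in degree 0. *)
Lemma exists_min_graded_free_res (I : pred A) :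
  0 \in I -> (forall c p q, p \in I -> q \in I -> c * p + q \in I) ->
  (forall e p, p \in I -> component 0 e p \in I) ->
  (forall p, p \in I -> p@_0%MM = 0) ->
  exists rk gdeg aug dif, @min_graded_free_res k n w I rk gdeg aug dif.
Proof.
move=> I0 IMD Icomp Icst.
pose z (_ : 'I_1) := 0%N.
have [|N0 [h0 [D0 [hom0 min0 gen0]]]] := @minimal_generators _ z (fun u => u 0 0 \in I).
  split=> [|e u Iu]; last by rewrite mxE; exact: Icomp.
  by split=> [|c u v Iu Iv]; rewrite !mxE //; exact: IMD.
have next st := boolp.cid (next_stage st).
pose st0 := Stage h0 z D0.
pose st d := iter d (fun s => Stage (projT2 (sval (next s))).1 (@stage_deg s)
  (projT2 (sval (next s))).2) st0.
have st_valid d : valid_stage (st d).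
  by elim: d => [|d IH] //=; case: (svalP (next (st d)) IH).
have stP d := svalP (next (st d)) (st_valid d).
exists (fun d => stage_rk (st d)), (fun d => @stage_deg (st d)), D0,
  (fun d => stage_mx (st d.+1)); split.
- by move=> j u /hom0; rewrite addn0.
- move=> d j i; apply: homog_mx_whomog; exact: (st_valid d.+1).1.
- split=> [j|d j i]; last by case: (stP d).
  apply: Icst; have /gen0 : exists v, row j D0 = v *m D0.
    by exists (delta_mx 0 j); rewrite -rowE.
  by rewrite mxE.
- move=> p; split=> [Ip|[v <-]]; last by apply/gen0; exists v.
  have /gen0[v def_p] : (const_mx p : 'rV_1) 0 0 \in I by rewrite mxE.
  by exists v; rewrite -def_p mxE.
- by split=> [|d]; [case: (stP 0%N) | case: (stP d.+1)].
Qed.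
End Homogeneous.

(** * Betti numbers of toric ideals *)

(** All monomials of weight [e] have the same image, and their coefficients in [p] sum to 0. *)
Lemma toric_component (k : fieldType) n (w : 'I_n -> nat) e (p : {mpoly k[n]}) :
  p \in @toric_ideal k n w -> component w 0 e p \in @toric_ideal k n w.
Proof.
move=> Ip; rewrite unfold_in raddf_sum /=.
rewrite (eq_bigr (fun u => p@_u *: 'X^e)) => [|u].
  under eq_bigl do rewrite addn0.
  by rewrite -scaler_suml (toric_coef e Ip) scale0r.
by rewrite addn0 mmapZ /= toric_mapX mul_polyC => /eqP->.
Qed.

(** With positive weights, 1 is the only monomial of weight 0. *)
Lemma toric_coef0 (k : fieldType) n (w : 'I_n -> nat) (p : {mpoly k[n]}) :
  (forall i, (0 < w i)%N) -> p \in @toric_ideal k n w -> p@_0%MM = 0.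
Proof.
move=> w_gt0 /(toric_coef 0) <-; rewrite [p in LHS]mpolyE raddf_sum /= big_mkcond.
rewrite [RHS]big_mkcond; apply: eq_bigr => u _; rewrite mcoeffZ mcoeffX.
case: eqP => [->|u0]; first by rewrite wdeg0 eqxx mulr1.
by case: eqP => [/(wdeg_eq0 w_gt0)//|_]; rewrite mulr0.
Qed.

Lemma toric_resolution (k : fieldType) n (w : 'I_n -> nat) : (forall i, (0 < w i)%N) ->
  exists rk gdeg aug dif, @min_graded_free_res k n w (@toric_ideal k n w) rk gdeg aug dif.
Proof.
move=> w_gt0; apply: exists_min_graded_free_res => //.
- exact: toric0.
- exact: toric_submodule.
- exact: toric_component.
- by move=> p; exact: toric_coef0.
Qed.

Lemma toric_betti_eq (k : fieldType) n (v w : 'I_n -> nat) (i0 : 'I_n) d :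
  (forall i, (0 < v i)%N) -> (forall i, (0 < w i)%N) ->
  (forall p, p \in @toric_ideal k n v ->
     exists2 q, q \in @toric_ideal k n w & exists c, p = q + 'X_i0 * c) ->
  (forall p, p \in @toric_ideal k n w ->
     exists2 q, q \in @toric_ideal k n v & exists c, p = q + 'X_i0 * c) ->
  exists b, betti v (@toric_ideal k n v) d b /\ betti w (@toric_ideal k n w) d b.
Proof.
move=> v_gt0 w_gt0 vw wv.
have resv := toric_resolution k v_gt0; have resw := toric_resolution k w_gt0.
have [rk [gdeg [aug [dif res]]]] := resv; exists (rk d).
have X0 : ('X_i0 : {mpoly k[n]}) != 0.
  apply/eqP => /(congr1 (mcoeff U_(i0)%MM)); rewrite mcoeffXU eqxx mcoeff0.
  exact/eqP/oner_neq0.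
have X_0 : ('X_i0 : {mpoly k[n]})@_0%MM = 0 by rewrite mcoeffX mnm1_eq0.
have nz u p := @toric_cancelX k n u i0 p.
have refl u (p : {mpoly k[n]}) : p \in @toric_ideal k n u ->
    exists2 q, q \in @toric_ideal k n u & exists c, p = q + 'X_i0 * c.
  by exists p => //; exists 0; rewrite mulr0 addr0.
(* Comparing the ideal of [v] with itself shows that its ranks do not depend on the resolution;
   comparing it with the ideal of [w] gives the same ranks there. *)
split; split=> // rk' gdeg' aug' dif' res'; apply/eqP; rewrite eqn_leq.
  apply/andP; split.
    by apply: resolution_rank_le res' res X0 X_0 _ _ _ _; (exact: nz || exact: refl).
  by apply: resolution_rank_le res res' X0 X_0 _ _ _ _; (exact: nz || exact: refl).
apply/andP; split.
  by apply: resolution_rank_le res' res X0 X_0 _ _ _ _ => //; exact: nz.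
by apply: resolution_rank_le res res' X0 X_0 _ _ _ _ => //; exact: nz.
Qed.

Lemma apery_betti_eq (k : fieldType) (S T : pred nat) m (a b : 'I_m -> nat)
    n (e : 'I_n -> 'I_m) (i0 : 'I_n) d :
  numerical_semigroup S -> multiplicity S m -> apery_vec S a ->
  numerical_semigroup T -> multiplicity T m -> apery_vec T b ->
  sums_transfer a b -> sums_transfer b a -> e i0 = 0%N :> nat ->
  (forall i : 'I_m, (i : nat) != 0%N -> atomb S (a i) -> exists j, e j = i) ->
  let v j := apery_weights a (e j) in let w j := apery_weights b (e j) in
  exists c, betti v (@toric_ideal k n v) d c /\ betti w (@toric_ideal k n w) d c.
Proof.
move=> semiS multS aP semiT multT bP ab ba ei0 atoms v w.
apply: (@toric_betti_eq _ _ v w i0).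
- by move=> i; exact (apery_weights_gt0 semiS multS aP (e i)).
- by move=> i; exact (apery_weights_gt0 semiT multT bP (e i)).
- apply: (toric_apery_sub semiS multS aP semiT multT bP) => // i i_neq0 at_i.
  by apply: atoms => //; exact: (atomb_transfer semiS multS aP semiT multT bP).
- exact: (toric_apery_sub semiT multT bP semiS multS aP).
Qed.

Theorem theorem4p3 (R : realType) (k : fieldType) (m : nat)
    (S T : pred nat) (aS aT : 'I_m -> nat) :
  (2 <= m)%N ->
  numerical_semigroup S -> numerical_semigroup T ->
  multiplicity S m -> multiplicity T m ->
  apery_vec S aS -> apery_vec T aT ->
  (exists F : ('I_m -> R) -> Prop,
     [/\ is_face (@kunz_cone R m) F,
         rel_interior F (apery_point R aS) &
         rel_interior F (apery_point R aT)]) ->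
  forall d : nat,
    (exists b, betti (apery_weights aS) (@J_ideal k m aS) d b /\
               betti (apery_weights aT) (@J_ideal k m aT) d b) /\
    (exists b, betti (@gen_weights S m aS) (@I_ideal k S m aS) d b /\
               betti (@gen_weights T m aT) (@I_ideal k T m aT) d b).
Proof.
move=> m_ge2 semiS semiT multS multT aSP aTP [F [faceF FS FT]] d.
have ST := face_sums_transfer semiS multS aSP semiT multT aTP faceF FS FT.
have TS := face_sums_transfer semiT multT aTP semiS multS aSP faceF FT FS.
have m_gt0 := ltnW m_ge2; pose o : 'I_m := Ordinal m_gt0.
split.
  apply: (@apery_betti_eq k S T m aS aT m id o) => // i _ _.
  by exists i.
(* The atoms sit in the same residue classes, so both defining ideals live in the same polynomial
   ring. *)
have genST : gen_vars T aT = gen_vars S aS.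
  apply/setP => j; rewrite !inE; congr (_ || _); apply/idP/idP.
    exact: (atomb_transfer semiS multS aSP semiT multT aTP).
  exact: (atomb_transfer semiT multT aTP semiS multS aSP).
rewrite /I_ideal /gen_weights genST.
have oG : o \in gen_vars S aS by rewrite inE eqxx.
apply: (@apery_betti_eq k S T m aS aT _ (@enum_val _ (mem (gen_vars S aS)))
  (enum_rank_in oG o)) => //.
  by rewrite enum_rankK_in.
move=> i _ at_i; have iG : i \in gen_vars S aS by rewrite inE at_i orbT.
by exists (enum_rank_in oG i); rewrite enum_rankK_in.
Qed.
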